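(* Let $S\subset\mathbb{R}^d$ be a compact set which is $r$-convex for some $r>0$. Then $S$ fulfills the (outside) $r$-rolling condition.
   Context: $\mathring{B}(x,r)$ is the open ball in $\mathbb{R}^d$ with centre $x$ and radius $r$ (Euclidean norm), and $\partial S$ is the topological boundary of $S$. $r$-convexity: a set $S\subset\mathbb{R}^d$ is $r$-convex if $S=C_r(S)$, where $C_r(S)=\bigcap_{\{y:\ \mathring{B}(y,r)\cap S=\emptyset\}}\mathring{B}(y,r)^c$. Equivalently, for every $x\in S^c$ there exists $y\in\mathring{B}(x,r)$ with $\mathring{B}(y,r)\cap S=\emptyset$. Rolling condition: a set $S\subset\mathbb{R}^d$ fulfills the (outside) $r$-rolling condition if for every $x\in\partial S$ there is a closed ball $B_x$ of radius $r$ such that $x\in B_x$ and $\mathrm{int}(B_x)\cap S=\emptyset$. *)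

(* Defs.v *)
From mathcomp Require Import all_boot all_order all_algebra.
From mathcomp Require Import all_classical all_reals all_analysis.

Set Implicit Arguments.
Unset Strict Implicit.
Unset Printing Implicit Defensive.

Import Order.TTheory GRing.Theory Num.Theory.
Import numFieldNormedType.Exports.

Local Open Scope classical_set_scope.
Local Open Scope ring_scope.

(* R^d is 'rV[R]_d. The library norm `|v| (and hence [ball]) on 'rV[R]_d is the
   sup norm, so the Euclidean norm and its balls are defined here. All norms on
   R^d being equivalent, the library topology on 'rV[R]_d ([compact],
   [closure], [interior]) is the usual Euclidean one. *)
Definition enorm (R : realType) (d : nat) (v : 'rV[R]_d) : R :=
  Num.sqrt (\sum_(i < d) v ord0 i ^+ 2).

Definition open_eball (R : realType) (d : nat) (x : 'rV[R]_d) (r : R) :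
  set 'rV[R]_d := [set z | enorm (z - x) < r].

Definition closed_eball (R : realType) (d : nat) (x : 'rV[R]_d) (r : R) :
  set 'rV[R]_d := [set z | enorm (z - x) <= r].

Definition boundary (T : topologicalType) (S : set T) : set T :=
  closure S `\` interior S.

Definition rhull (R : realType) (d : nat) (r : R) (S : set 'rV[R]_d) :
  set 'rV[R]_d :=
  \bigcap_(y in [set y | open_eball y r `&` S = set0]) ~` open_eball y r.

Definition rconvex (R : realType) (d : nat) (r : R) (S : set 'rV[R]_d) : Prop :=
  S = rhull r S.

Definition outside_rolling (R : realType) (d : nat) (r : R)
  (S : set 'rV[R]_d) : Prop :=
  forall x, boundary S x ->
    exists c : 'rV[R]_d,
      closed_eball c r x /\ interior (closed_eball c r) `&` S = set0.

(* Main.v *)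
Require Import Defs.
From mathcomp Require Import all_boot all_order all_algebra.
From mathcomp Require Import all_classical all_reals all_analysis.
Import Order.TTheory GRing.Theory Num.Theory.
Import numFieldNormedType.Exports.
Local Open Scope classical_set_scope.
Local Open Scope ring_scope.

(** Let K be the set of centres c whose open ball of radius r misses S.
    By r-convexity every point outside S lies in the open r-ball of some
    c in K, so the complement of S is contained in the union E of the closed
    r-balls centred in K. A boundary point x of S is a limit of points of the
    complement of S. Hence x lies in E as soon as E is closed, and the ball of
    E containing x is the one that rolls to x: its interior is contained in the
    open ball, which misses S.

    The set E is closed because K is closed ([closed_empty_ball_centers]) and
    because the centres of the balls that come close to x stay in a fixed
    compact box, so that these centres cannot escape to infinity
    ([closed_bigcup_closed_eball]). *)

Lemma coord_le_enorm (R : realType) (d : nat) (v : 'rV[R]_d) (i : 'I_d) :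
  `|v ord0 i| <= enorm v.
Proof.
rewrite -sqrtr_sqr ler_wsqrtr // (bigD1 i) //= lerDl.
by apply: sumr_ge0 => j _; exact: sqr_ge0.
Qed.

Lemma enormZ (R : realType) (d : nat) (t : R) (v : 'rV[R]_d) :
  enorm (t *: v) = `|t| * enorm v.
Proof.
rewrite -sqrtr_sqr -sqrtrM ?sqr_ge0 // mulr_sumr.
by congr Num.sqrt; apply: eq_bigr => i _; rewrite mxE exprMn.
Qed.

Lemma enorm_continuous (R : realType) (d : nat) :
  continuous (@enorm R d).
Proof.
have sumsq : continuous (fun v : 'rV[R]_d => \sum_(i < d) v ord0 i ^+ 2).
  apply: (@continuous_big R 'I_d +%R 0 _ (@add_continuous R) 'rV[R]_d) => i _ v.
  by have vi := @coord_continuous R 1 d ord0 i v; exact: (cvgM vi vi).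
move=> v; apply: (@continuous_comp _ _ _ _ (@Num.sqrt R)); first exact: sumsq.
exact: sqrt_continuous.
Qed.

Lemma edist_continuous (R : realType) (d : nat) :
  continuous (fun p : 'rV[R]_d * 'rV[R]_d => enorm (p.2 - p.1)).
Proof.
move=> p.
have dp : q.2 - q.1 @[q --> p] --> p.2 - p.1.
  exact: (@cvgB R 'rV[R]_d _ (nbhs p) _ _ _ _ _ cvg_snd cvg_fst).
exact: (cvg_comp _ _ dp (@enorm_continuous _ _ _)).
Qed.

(** A point z on the sphere can be pushed slightly away from c along z - c, and
    so leaves the closed ball. Positivity of r matters: for r = 0 in dimension 0
    the closed ball is the whole space while the open one is empty. *)
Lemma interior_closed_eball (R : realType) (d : nat) (c : 'rV[R]_d) (r : R) :
  0 < r -> interior (closed_eball c r) `<=` open_eball c r.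
Proof.
move=> r0 z zint; have := nbhs_singleton zint; rewrite /closed_eball /=.
rewrite le_eqVlt => /predU1P[zr|//]; exfalso.
pose g (t : R) := z + t *: (z - c).
have g0 : g t @[t --> (0 : R)] --> z.
  have -> : z = z + 0 *: (z - c) by rewrite scale0r addr0.
  by apply: cvgD; [exact: cvg_cst | apply: cvgZr_tmp].
have := g0 _ zint => /nbhs_ballP[e /= e0 eg].
have /eg : ball (0 : R) e (e / 2).
  rewrite /ball /= sub0r normrN gtr0_norm ?divr_gt0 //.
  by rewrite ltr_pdivrMr // ltr_pMr ?ltr1n.
rewrite /closed_eball /g /=.
have -> : z + (e / 2) *: (z - c) - c = (1 + e / 2) *: (z - c).
  by rewrite scalerDl scale1r addrAC.
have e20 : 0 < e / 2 by rewrite divr_gt0.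
by rewrite enormZ zr gtr0_norm ?addr_gt0 // leNgt ltr_pMl // ltrDl e20.
Qed.

(** The condition on c says that c is at distance at least r from each point of
    S, which is an intersection of closed conditions. *)
Lemma closed_empty_ball_centers (R : realType) (d : nat) (r : R)
    (S : set 'rV[R]_d) :
  closed [set c | open_eball c r `&` S = set0].
Proof.
have -> : [set c | open_eball c r `&` S = set0] =
    \bigcap_(s in S) (fun c => enorm (s - c)) @^-1` [set t | r <= t].
  apply/seteqP; split => [c cS s Ss | c cS] /=.
    rewrite leNgt; apply/negP => scr.
    by have : set0 s by rewrite -cS.
  by apply/disjoints_subset => s scr /cS /=; rewrite leNgt scr.
apply: closed_bigI => s _; apply: preimage_closed; last exact: closed_ge.
move=> c _.
have cs : (c', s) @[c' --> c] --> (c, s).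
  exact: (@cvg_pair _ _ _ (nbhs c) _ _ _ _ _ _ _ cvg_id (cvg_cst s)).
exact: (cvg_comp _ _ cs (@edist_continuous _ _ _)).
Qed.

(** This is the closedness of a sum of a closed set and a compact set. For x
    outside the union, each c has a neighbourhood on which c' in K and
    |z - c'| <= r are incompatible for z near x. Covering a compact box of
    centres by such neighbourhoods yields one neighbourhood of x that works for
    the whole box, and a ball meeting the unit neighbourhood of x has its
    centre in the box. *)
Lemma closed_bigcup_closed_eball (R : realType) (d : nat) (r : R)
    (K : set 'rV[R]_d) :
  closed K -> closed (\bigcup_(c in K) closed_eball c r).
Proof.
move=> clK x xE; apply: contrapT => nEx.
(* Coordinatewise r + 1 bounds |x - c| through a point z with |x - z| < 1 and
   |z - c| <= r; comparing coordinates avoids the Euclidean triangle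
   inequality. *)
pose I i := `[x ord0 i - (r + 1), x ord0 i + (r + 1)]%classic.
pose B : set 'rV[R]_d := [set c | forall i, I i (c ord0 i)].
have /compact_near_coveringP cB : compact B.
  by apply: (@rV_compact _ _ I) => i; exact: segment_compact.
have far : \forall z \near x, B `<=` [set c | K c -> r < enorm (z - c)].
  apply: (cB _ (nbhs x) (fun z c => K c -> r < enorm (z - c))) => c _.
  have [Kc|nKc] := pselect (K c).
    have rxc : r < enorm (x - c).
      by rewrite ltNge; apply/negP => xcr; apply: nEx; exists c.
    by apply: filterS (cvgr_gt _ (@edist_continuous _ _ (c, x)) _ rxc) => p.
  have : \forall p \near (c, x), ~ K p.1.
    apply: (@cvg_fst _ _ (nbhs c) (nbhs x) _ (~` K)).
    by apply: open_nbhs_nbhs; split => //; exact: closed_openC.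
  by apply: filterS => p nKp /nKp.
have near1 : nbhs x (ball x 1) by apply: nbhsx_ballx.
have [z [[c Kc zc] [zfar [_ zx]]]] := xE _ (filterI far near1).
suff Bc : B c by have := zfar _ Bc Kc; rewrite ltNge => /negP; apply.
move=> i; rewrite /I /= in_itv /= -ler_distl.
have := zx ord0 i; rewrite /ball /= => /ltW zxi.
have := le_trans (coord_le_enorm _ _ _ i) zc; rewrite !mxE => zci.
rewrite distrC -(subrKA (z ord0 i)) addrC.
by apply: le_trans (ler_normD _ _) _; apply: lerD.
Qed.

Lemma setC_rhull (R : realType) (d : nat) (r : R) (S : set 'rV[R]_d) :
  ~` rhull r S =
  \bigcup_(c in [set c | open_eball c r `&` S = set0]) open_eball c r.
Proof.
by rewrite /rhull setC_bigcap; apply: eq_bigcupr => c _; rewrite setCK.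
Qed.

Theorem proposition2 (R : realType) (d : nat) (S : set 'rV[R]_d) (r : R)
  (hr : 0 < r) (Scompact : compact S) (Sconvex : rconvex r S) :
  outside_rolling r S.
Proof.
move=> x [_ xNint].
pose K := [set c | open_eball c r `&` S = set0].
have SC : ~` S `<=` \bigcup_(c in K) closed_eball c r.
  by rewrite {1}Sconvex setC_rhull => y [c Kc /ltW yc]; exists c.
have xcl : closure (~` S) x by rewrite closure_setC.
have [c Kc xc] : (\bigcup_(c in K) closed_eball c r) x.
  apply: closed_bigcup_closed_eball; first exact: closed_empty_ball_centers.
  exact: closure_subset SC _ xcl.
exists c; split => //; apply/disjoints_subset => y.
move=> /(interior_closed_eball _ _ _ _ hr).
by have /disjoints_subset := Kc; apply.
Qed.
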